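(* Let $d\ge1$, $p\in[1,\infty)$ and $s\in(0,1)$. There exists a constant $C>0$ depending only on $d,s,p$ such that for every $f\in W^{s,p}(\mathbb{R}^d)$ and all $x,y\in\mathbb{R}^d$ with $x\ne y$, $$|f(x)-f(y)|\le C\,|x-y|^s\,\big(D_{s,p}f(x)+D_{s,p}f(y)\big),$$ where $$D_{s,p}f(x):=\left(\int_{\mathbb{R}^d}\frac{|f(x+h)-f(x)|^p}{|h|^{d+ps}}\,dh\right)^{1/p}\in[0,\infty]$$ and $D_{s,p}f\in L^p(\mathbb{R}^d)$.
   Context: Functions are real-valued, measurable and everywhere defined on $\mathbb{R}^d$ (a representative is fixed). $W^{s,p}(\mathbb{R}^d)$ is the set of $f\in L^p(\mathbb{R}^d)$ such that $$\int_{\mathbb{R}^d}\int_{\mathbb{R}^d}\frac{|f(x+h)-f(x)|^p}{|h|^{d+ps}}\,dx\,dh<\infty .$$ *)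

(* Defs.v *)
From HB Require Import structures.
From mathcomp Require Import all_boot all_order all_algebra.
From mathcomp Require Import all_classical all_reals all_analysis.
From mathcomp Require Import measurable_realfun.
Set Implicit Arguments.
Unset Strict Implicit.
Unset Printing Implicit Defensive.
Import Order.TTheory GRing.Theory Num.Theory.
Import numFieldNormedType.Exports.
Local Open Scope classical_set_scope.
Local Open Scope ring_scope.

(* The Borel sigma-algebra of R^n, generated by the coordinate maps. *)
Definition rV_display : measure_display.
Proof. exact: default_measure_display. Qed.

Section rV_measurable.
Context {R : realType} (n : nat).

Definition rV_coord (i : 'I_n) (v : 'rV[R]_n) : measurableTypeR R := v ord0 i.

Let rV_set0 : g_sigma_preimage rV_coord set0.
Proof. exact: sigma_algebra0. Qed.

Let rV_setC A : g_sigma_preimage rV_coord A -> g_sigma_preimage rV_coord (~` A).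
Proof. exact: sigma_algebraC. Qed.

Let rV_bigcup (F : (set 'rV[R]_n)^nat) :
  (forall i, g_sigma_preimage rV_coord (F i)) ->
  g_sigma_preimage rV_coord (\bigcup_i (F i)).
Proof. exact: sigma_algebra_bigcup. Qed.

HB.instance Definition _ := @isMeasurable.Build rV_display
  'rV[R]_n (g_sigma_preimage rV_coord) rV_set0 rV_setC rV_bigcup.

Lemma measurable_rV_coord (i : 'I_n) :
  measurable_fun [set: 'rV[R]_n] (rV_coord i).
Proof.
move=> _ Y mY; rewrite setTI; apply: sub_sigma_algebra => /=.
rewrite -bigcup_seq/=; exists i => /=; first by rewrite mem_index_enum.
by exists Y => //; rewrite setTI.
Qed.

Lemma measurable_fun_rV d (T : measurableType d) (f : T -> 'rV[R]_n) :
  (forall i, measurable_fun [set: T] (rV_coord i \o f)) ->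
  measurable_fun [set: T] f.
Proof.
move=> mf _ Y mY; rewrite setTI.
have : preimage_set_system setT f measurable (f @^-1` Y).
  by exists Y; rewrite ?setTI.
rewrite /measurable/= -g_sigma_preimage_comp; move: (f @^-1` Y).
apply: smallest_sub; first exact: sigma_algebra_measurable.
rewrite -bigcup_seq => A [i _ [B mB <-]]; exact: mf.
Qed.

End rV_measurable.

Section rV_cons.
Context {R : realType} (n : nat).

Definition rV_cons (x : measurableTypeR R * 'rV[R]_n) : 'rV[R]_n.+1 :=
  \row_i oapp (x.2 ord0) x.1 (unlift ord0 i).

Definition rV_uncons (v : 'rV[R]_n.+1) : measurableTypeR R * 'rV[R]_n :=
  (v ord0 ord0, \row_i v ord0 (lift ord0 i)).

Lemma rV_consK : cancel rV_cons rV_uncons.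
Proof.
move=> [a v]; rewrite /rV_uncons /rV_cons !mxE unlift_none/=; congr pair.
by apply/rowP => i; rewrite !mxE liftK.
Qed.

Lemma measurable_rV_cons : measurable_fun setT rV_cons.
Proof.
apply: measurable_fun_rV => i.
rewrite (_ : _ \o _ =
  fun x => oapp (@rV_coord R n ^~ x.2) x.1 (unlift ord0 i)); last first.
  by apply/funext => x; rewrite /rV_coord/= mxE; case: unliftP.
case: unliftP => [j _|_] /=; last exact: measurable_fst.
by apply: (measurableT_comp (measurable_rV_coord j)); exact: measurable_snd.
Qed.

Lemma measurable_rV_uncons : measurable_fun setT rV_uncons.
Proof.
apply: measurable_fun_pair; first exact: (measurable_rV_coord ord0).
apply: measurable_fun_rV => i.
rewrite (_ : _ \o _ = rV_coord (lift ord0 i)); first exact: measurable_rV_coord.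
by apply/funext => v; rewrite /rV_coord/= mxE.
Qed.

End rV_cons.

Section lebesgue_cons.
Context {R : realType} (n : nat).
Variable m : {sigma_finite_measure set 'rV[R]_n -> \bar R}.
Local Open Scope ereal_scope.

Definition lebesgue_cons : set 'rV[R]_n.+1 -> \bar R :=
  pushforward (@lebesgue_measure R \x m) (@rV_cons R n).

Let mcons := @measurable_rV_cons R n.

Let lebesgue_cons0 : lebesgue_cons set0 = 0.
Proof. exact: measure0. Qed.

Let lebesgue_cons_ge0 A : 0 <= lebesgue_cons A.
Proof. exact: measure_ge0. Qed.

Let lebesgue_cons_sigma_additive : semi_sigma_additive lebesgue_cons.
Proof. exact: measure_semi_sigma_additive. Qed.

HB.instance Definition _ := isMeasure.Build _ _ _ lebesgue_cons
  lebesgue_cons0 lebesgue_cons_ge0 lebesgue_cons_sigma_additive.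

Let lebesgue_cons_sigma_finite : sigma_finite setT lebesgue_cons.
Proof.
have /sigma_finiteP[F [FT ndF Foo]] := sigma_finiteT (@lebesgue_measure R).
have /sigma_finiteP[G [GT ndG Goo]] := sigma_finiteT m.
exists (fun k => @rV_uncons R n @^-1` (F k `*` G k)).
  apply/esym; rewrite -subTset => v _.
  have [i _ Fi] : (\bigcup_i F i) (rV_uncons v).1 by rewrite -FT.
  have [j _ Gj] : (\bigcup_j G j) (rV_uncons v).2 by rewrite -GT.
  exists (maxn i j) => //; split.
    exact: (subsetPset _ _ (ndF _ _ (leq_maxl i j))).
  exact: (subsetPset _ _ (ndG _ _ (leq_maxr i j))).
move=> k; have [mFk Fk] := Foo k; have [mGk Gk] := Goo k.
have mFG : measurable (F k `*` G k) by exact: measurableX.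
split; first by rewrite -[X in measurable X]setTI; exact: measurable_rV_uncons.
rewrite /lebesgue_cons /pushforward -comp_preimage.
rewrite (_ : _ \o _ = id); last by apply/funext => x; exact: rV_consK.
by rewrite preimage_id product_measure1E// lte_mul_pinfty// ge0_fin_numE.
Qed.

HB.instance Definition _ := Measure_isSigmaFinite.Build _ _ _ lebesgue_cons
  lebesgue_cons_sigma_finite.

End lebesgue_cons.

(* The n-fold product of the Lebesgue measure of R, on the Borel sets of R^n. *)
Fixpoint borel_lebesgue (R : realType) (n : nat) :
    {sigma_finite_measure set 'rV[R]_n -> \bar R} :=
  match n with
  | 0 => \d_(0 : 'rV[R]_0)
  | n'.+1 => lebesgue_cons (borel_lebesgue R n')
  end.

(* R^n with the Lebesgue sigma-algebra, and Lebesgue measure on it: the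
   Caratheodory extension (i.e. the completion) of [borel_lebesgue]. *)
Definition lebesgue_rV_type (R : realType) (n : nat) : measurableType _ :=
  caratheodory_type ((borel_lebesgue R n)^*)%mu.

Definition lebesgue_rV (R : realType) (n : nat) :
    {measure set (lebesgue_rV_type R n) -> \bar R} :=
  @completed_measure_extension _ _ _ (borel_lebesgue R n).

Section fractional_sobolev.
Context {R : realType} (d : nat).
Implicit Types (s p : R) (f : 'rV[R]_d -> R) (x y h : 'rV[R]_d).

(* Euclidean norm; the library's [`|x|] on ['rV[R]_d] is the sup norm. *)
Definition enorm x : R := Num.sqrt (\sum_(i < d) x ord0 i ^+ 2).

(* Equal to 0 at [h = 0], by the conventions of [powR] and division. *)
Definition diff_quot s p f x h : R :=
  `|f (x + h) - f x| `^ p / enorm h `^ (d%:R + p * s).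

Local Open Scope ereal_scope.
Local Notation mu := (lebesgue_rV R d).

Definition Wsp s p : set ('rV[R]_d -> R) :=
  [set f | (f : lebesgue_rV_type R d -> R) \in Lfun mu p%:E /\
           \int[mu]_h \int[mu]_x (diff_quot s p f x h)%:E < +oo].

Definition Dsp s p f x : \bar R :=
  (\int[mu]_h (diff_quot s p f x h)%:E) `^ p^-1.

(* Membership in L^p of an extended real-valued function; the library's [Lfun]
   is restricted to real-valued functions. *)
Definition in_Lp p (g : lebesgue_rV_type R d -> \bar R) : Prop :=
  measurable_fun setT g /\ 'N[mu]_(p%:E)[g] < +oo.

End fractional_sobolev.

(* Main.v *)
Require Import Defs.
From mathcomp Require Import all_boot all_order all_algebra.
From mathcomp Require Import all_classical all_reals all_analysis.
From mathcomp Require Import measurable_realfun ring.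
Import Order.TTheory GRing.Theory Num.Theory.
Import numFieldNormedType.Exports.
Local Open Scope classical_set_scope.
Local Open Scope ring_scope.

(* Let r = |x - y|. For every z in the cube of half-side r around x, the numbers
   |z - x| and |z - y| are at most 2 d r, so |f x - f y|^p is at most
   2^p (2 d r)^(d + p s) times the sum of the two difference quotients of f at
   (x, z - x) and (y, z - y). Integrating over the cube, whose volume is (2 r)^d,
   and using translation invariance gives
   |f x - f y|^p <= c r^(p s) (D f x ^ p + D f y ^ p).
   That D f is in L^p is Tonelli's theorem. *)

(** * Completion of a sigma-finite measure: measurable hulls and transfer of integrals *)

Section completion.
Local Open Scope ereal_scope.
Context {d} {T : measurableType d} {R : realType}.
Variable mu : {sigma_finite_measure set T -> \bar R}.
Local Notation cT := (caratheodory_type (mu^*)%mu).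
Local Notation cmu := (@completed_measure_extension _ _ _ mu).

(** Intersect measurable covers of [X] whose measures exceed the outer measure by at most 1/(n+1);
    if the outer measure is infinite, the whole space serves. *)
Lemma measurable_mu_ext_hull (X : set T) :
  exists F : set T, [/\ measurable F, X `<=` F & mu F = (mu^*)%mu X].
Proof.
have [Xoo|] := eqVneq ((mu^*)%mu X) +oo.
  exists setT; split => //; apply/eqP; rewrite Xoo -leye_eq -Xoo.
  by rewrite -(measurable_mu_extE mu measurableT); exact: le_mu_ext.
rewrite -ltey => Xoo.
have Xfin : (mu^*)%mu X \is a fin_num by rewrite ge0_fin_numE// mu_ext_ge0.
have cover n : exists A : set T, [/\ measurable A, X `<=` A &
    mu A <= (mu^*)%mu X + n.+1%:R^-1%:E].
  have n0 : (0 < n.+1%:R^-1 :> R)%R by rewrite invr_gt0.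
  have [_ [A [mA XA] <-] ltA] := lb_ereal_inf_adherent n0 Xfin.
  exists (\bigcup_k A k); split => //; first exact: bigcupT_measurable.
  apply: le_trans (ltW ltA).
  apply: measure_sigma_subadditive => //.
  exact: bigcupT_measurable.
have [A PA] := choice cover.
have mF : measurable (\bigcap_k A k).
  by apply: bigcapT_measurable => k; have [] := PA k.
exists (\bigcap_k A k); split => //.
  by move=> x Xx k _; have [_ + _] := PA k; exact.
apply/eqP; rewrite eq_le; apply/andP; split; last first.
  rewrite -(measurable_mu_extE mu mF); apply: le_mu_ext => x Xx k _.
  by have [_ + _] := PA k; exact.
apply/lee_addgt0Pr => _/posnumP[e]; near \oo => n.
have [mAn _ leAn] := PA n.
apply: (@le_trans _ _ (mu (A n))).
  by apply: le_measure; rewrite ?inE//; exact: bigcap_inf.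
apply: le_trans leAn _; rewrite leeD2l// lee_fin ltW//.
by near: n; apply: near_infty_natSinv_lt.
Unshelve. all: by end_near. Qed.

Lemma negligible_mu_ext (X : set T) : (mu^*)%mu X = 0 -> mu.-negligible X.
Proof.
move=> X0; have [N [mN XN muN]] := measurable_mu_ext_hull X.
by exists N; rewrite muN.
Qed.

Lemma sub_measurable_caratheodory (A : set T) :
  measurable A -> measurable (A : set cT).
Proof. exact: caratheodory_measurable_mu_ext. Qed.

(** Cut [E] along an exhaustion by sets of finite measure. Each piece and its hull have the same
    finite outer measure, and additivity on Caratheodory sets makes their difference null. The union
    of the hulls then works for [E]. *)
Lemma caratheodory_hull (E : set T) : measurable (E : set cT) ->
  exists F : set T, [/\ measurable F, E `<=` F & mu.-negligible (F `\` E)].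
Proof.
move=> mE.
have [S ST mS] := sigma_finiteT mu.
have hull n : exists F : set T,
    [/\ measurable F, E `&` S n `<=` F & mu.-negligible (F `\` E)].
  have [mSn Snoo] := mS n.
  have mES : measurable (E `&` S n : set cT).
    by apply: measurableI => //; exact: sub_measurable_caratheodory.
  have [F [mF EF muF]] := measurable_mu_ext_hull (E `&` S n).
  have Foo : mu F < +oo.
    rewrite muF; apply: le_lt_trans Snoo.
    apply: (@le_trans _ _ ((mu^*)%mu (S n))); last by rewrite measurable_mu_extE.
    by apply: le_mu_ext; exact: subIsetr.
  have mcF := sub_measurable_caratheodory _ mF.
  have FES : mu.-negligible (F `\` (E `&` S n)).
    apply: negligible_mu_ext.
    have := @measureD _ cT _ cmu F (E `&` S n) mcF mES.
    rewrite /= /completed_measure_extension (measurable_mu_extE mu mF).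
    move=> /(_ Foo) /= ->; rewrite setIidr// muF subee//.
    by rewrite -muF ge0_fin_numE.
  exists (F `&` S n); split.
  - exact: measurableI.
  - by move=> x [Ex Sx]; split => //; apply: EF.
  - by apply: negligibleS FES => x [[Fx Sx] Ex]; split => // -[].
have [F PF] := choice hull.
exists (\bigcup_n F n); split.
- by apply: bigcupT_measurable => n; have [] := PF n.
- move=> x Ex; have [n _ Snx] : (\bigcup_n S n) x by rewrite -ST.
  by exists n => //; have [_ + _] := PF n; apply.
- rewrite setDE setI_bigcupl; apply: negligible_bigcup => n.
  by rewrite -setDE; have [] := PF n.
Qed.

Lemma measurable_id_caratheodory : measurable_fun [set: cT] (id : cT -> T).
Proof.
move=> _ Y mY; rewrite setTI preimage_id.
exact: sub_measurable_caratheodory.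
Qed.

(** The identity map from [cT] to [T] pushes [cmu] forward to [mu], because the outer measure
    extends [mu]. *)
Lemma ge0_integral_caratheodory (g : T -> \bar R) : measurable_fun setT g ->
  (forall x, 0 <= g x) -> \int[cmu]_x g x = \int[mu]_x g x.
Proof.
move=> mg g0.
transitivity (\int[pushforward cmu (id : cT -> T)]_x g x).
  by rewrite (ge0_integral_pushforward measurable_id_caratheodory).
apply: eq_measure_integral => [|mid A mA _]; first exact: measurable_id_caratheodory.
exact: (@measurable_mu_extE _ _ _ mu).
Qed.

(** Replace the superlevel sets of [f] at rational levels by measurable hulls. The countably many
    excesses lie in one null set [N], and setting [f] to 0 on [N] gives [g]. *)
Lemma caratheodory_ae_measurable (f : T -> R) :
  measurable_fun [set: cT] (f : cT -> R) ->
  exists (g : T -> R) (N : set T), [/\ measurable_fun setT g, measurable N,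
    mu N = 0 & forall x, ~ N x -> f x = g x].
Proof.
move=> mf.
(* An enumeration of the rationals; an index that codes no rational is sent to 0, which merely
   repeats a level. *)
pose q n : rat := odflt 0%R (unpickle n).
have hull n : exists F : set T, [/\ measurable F,
    [set x | ratr (q n) <= f x]%R `<=` F &
    mu.-negligible (F `\` [set x | ratr (q n) <= f x]%R)].
  apply: caratheodory_hull.
  rewrite [X in measurable X](_ : _ = [set: cT] `&`
      f @^-1` `[ratr (q n), +oo[%classic).
    by apply: mf => //; exact: measurable_itv.
  by rewrite setTI; apply/seteqP; split => x/=; rewrite in_itv/= andbT.
have [F PF] := choice hull.
have [N [mN N0 FN]] : mu.-negligible
    (\bigcup_n (F n `\` [set x | ratr (q n) <= f x]%R)).
  by apply: negligible_bigcup => n; have [] := PF n.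
exists (f \_ (~` N)), N; split => //; last by move=> x Nx; rewrite patchT// inE.
apply/(measurable_restrictT _ (measurableC mN)).
move=> mNC; apply: (measurability _ (RGenOInfty.measurableE R)) => // _ [_ [r ->] <-].
(* Off [N] each hull [F n] coincides with its superlevel set, and [r < f x] holds exactly when some
   rational above [r] is at most [f x]. *)
rewrite [X in measurable X](_ : _ = ~` N `&`
    \bigcup_(n in [set n | (r < ratr (q n))%R]) F n).
  apply: measurableI; first exact: measurableC.
  by apply: bigcup_measurable => n _; have [] := PF n.
apply/seteqP; split => x/= [Nx].
  rewrite in_itv/= andbT => /rat_in_itvoo[r']; rewrite in_itv/= => /andP[rr' r'f].
  split => //; exists (pickle r').
    by rewrite /= /q pickleK.
  have [_ + _] := PF (pickle r'); apply => /=.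
  by rewrite /q pickleK ltW.
move=> [n /= rq Fn]; split => //; rewrite in_itv/= andbT (lt_le_trans rq)//.
by apply: contrapT => nf; apply: Nx; apply: FN; exists n.
Qed.

(** Completeness of [cmu] carries measurability from [v] to [u], and almost everywhere equality
    carries the integral. This is the bridge between Lebesgue and Borel integrands. *)
Lemma ge0_integral_caratheodory_ae (u v : T -> \bar R) (N : set T) :
  measurable N -> mu N = 0 -> (forall x, ~ N x -> u x = v x) ->
  measurable_fun setT v -> (forall x, 0 <= u x) -> (forall x, 0 <= v x) ->
  measurable_fun [set: cT] (u : cT -> \bar R) /\
  \int[cmu]_x u x = \int[mu]_x v x.
Proof.
move=> mN N0 uv mv u0 v0.
have mcv : measurable_fun [set: cT] (v : cT -> \bar R).
  exact: (measurableT_comp mv measurable_id_caratheodory).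
have vu : ae_eq cmu setT (v : cT -> \bar R) (u : cT -> \bar R).
  exists N; split.
  - exact: sub_measurable_caratheodory.
  - by rewrite -N0; exact: (@measurable_mu_extE _ _ _ mu).
  - by move=> x /= nuv; apply: contrapT => Nx; apply: nuv => _; rewrite uv.
have mcu : measurable_fun [set: cT] (u : cT -> \bar R).
  apply: (ae_measurable_fun _ vu mcv).
  exact: (@measure_is_complete_caratheodory _ _ (mu^*)%mu).
split => //; rewrite -ge0_integral_caratheodory//.
apply: (ge0_ae_eq_integral measurableT mcu mcv) => //.
exact: ae_eq_sym.
Qed.

End completion.

(** * Translation invariance of Lebesgue measure, and the volume of cubes *)

Section translation.
Context {R : realType}.

(** Lebesgue measure is determined by its values on half-open intervals, whose lengths a translation
    preserves. *)
Lemma lebesgue_measure_shift (a : R) (A : set (measurableTypeR R)) :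
  measurable A -> lebesgue_measure ((fun x => x + a) @^-1` A) = lebesgue_measure A.
Proof.
have mshift : measurable_fun [set: measurableTypeR R]
    ((fun x => x + a) : measurableTypeR R -> measurableTypeR R).
  exact: measurable_funD.
move=> mA.
rewrite -[LHS]/(pushforward (@lebesgue_measure R)
  ((fun x => x + a) : measurableTypeR R -> measurableTypeR R) A).
apply/esym; move: A mA; apply: lebesgue_measure_unique => //.
move=> X [[u v] _ <-] /=; rewrite /pushforward.
rewrite (_ : _ @^-1` _ = `]u - a, v - a]%classic); last first.
  by apply/seteqP; split => x /=; rewrite !in_itv/= ltrBlDr lerBrDr.
by rewrite !lebesgue_measure_itv/= !lte_fin ltrD2r -!EFinD opprD addrACA subrr addr0.
Qed.

Lemma measurable_rV_shift n (a : 'rV[R]_n) :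
  measurable_fun setT (fun x : 'rV[R]_n => x + a).
Proof.
apply: measurable_fun_rV => i.
rewrite (_ : _ \o _ = fun x => rV_coord i x + a ord0 i).
  by apply: measurable_funD => //; exact: measurable_rV_coord.
by apply/funext => x; rewrite /rV_coord /= mxE.
Qed.

(** Induction on [n] by slicing along the first coordinate: the tail [a'] translates each section,
    which the induction hypothesis absorbs, and the head of [a] translates the slicing variable,
    which the one-dimensional case absorbs. *)
Lemma borel_lebesgue_shift n (a : 'rV[R]_n) (A : set 'rV[R]_n) :
  measurable A -> borel_lebesgue R n ((fun x => x + a) @^-1` A) = borel_lebesgue R n A.
Proof.
elim: n a A => [|n IH] a A mA.
  by congr (borel_lebesgue R 0 _); apply/seteqP; split => x /=;
    rewrite (_ : x + a = x)//; apply/rowP => -[].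
have mA' : measurable (@rV_cons R n @^-1` A).
  by rewrite -[X in measurable X]setTI; exact: measurable_rV_cons.
pose a' := (rV_uncons a).2.
pose h (t : measurableTypeR R) :=
  borel_lebesgue R n (xsection (@rV_cons R n @^-1` A) t).
have mh : measurable_fun setT h by exact: measurable_fun_xsection.
have mshift : measurable_fun [set: measurableTypeR R]
    ((fun x => x + a ord0 ord0) : measurableTypeR R -> measurableTypeR R).
  exact: measurable_funD.
rewrite /= /lebesgue_cons /pushforward /product_measure1.
transitivity (\int[@lebesgue_measure R]_t h ((t : R) + a ord0 ord0)%R)%E.
  apply: eq_integral => t _; rewrite /h /= -[RHS](IH a'); last first.
    exact: measurable_xsection.
  congr (borel_lebesgue R n _); apply/seteqP.
  have E v : rV_cons (t, v) + a = rV_cons (t + a ord0 ord0, v + a').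
    apply/rowP => i; rewrite !mxE /=; case: unliftP => [j|] ->//=.
    by rewrite !mxE.
  by split => v; rewrite /xsection /= !inE/= E.
transitivity (\int[@lebesgue_measure R]_t h t)%E; last by [].
rewrite -(@ge0_integral_pushforward _ _ _ _ _ _ mshift lebesgue_measure setT h)//.
by apply: eq_measure_integral => B mB _; exact: lebesgue_measure_shift.
Qed.

Lemma measurable_cube n (r : R) :
  measurable [set x : 'rV[R]_n | forall i, `|x ord0 i| <= r].
Proof.
rewrite (_ : mkset _ = \bigcap_i (setT `&` @rV_coord R n i @^-1` `[- r, r]%classic)).
  apply: fin_bigcap_measurable => // i _; exact: measurable_rV_coord.
apply/seteqP; split => x /= H i.
  by move=> _; split => //; rewrite /= in_itv/= -ler_norml; exact: H.
by have [_] := H i I; rewrite /= in_itv/= -ler_norml.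
Qed.

(** A cube is an interval times a cube of one dimension less; in dimension 0 it is the single point,
    of Dirac mass 1. *)
Lemma borel_lebesgue_cube n (r : R) : 0 < r ->
  borel_lebesgue R n [set x | forall i, `|x ord0 i| <= r] = ((r *+ 2) ^+ n)%:E.
Proof.
move=> r0; elim: n => [|n IH].
  by rewrite /= diracE mem_set// => -[].
rewrite /= /lebesgue_cons /pushforward.
rewrite (_ : _ @^-1` _ =
    `[- r, r]%classic `*` [set x : 'rV[R]_n | forall i, `|x ord0 i| <= r]).
  rewrite product_measure1E; [|exact: measurable_itv|exact: measurable_cube].
  rewrite IH exprS EFinM; congr (_ * _)%E.
  rewrite -[LHS]/(lebesgue_measure (`[- r, r]%classic : set R)).
  by rewrite lebesgue_measure_itv/= lte_fin gtrN// -EFinD opprK mulr2n.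
apply/seteqP; split => -[t v] /=; rewrite in_itv/= -ler_norml.
  move=> H; split; first by have := H ord0; rewrite mxE unlift_none.
  by move=> i; have := H (lift ord0 i); rewrite mxE liftK.
by move=> [tr vr] i; rewrite mxE /=; case: unliftP => [j _|_] /=; [exact: vr|exact: tr].
Qed.

(** Translating a Borel hull shows that a translation cannot increase the outer measure; the
    opposite translation gives the reverse inequality. *)
Lemma mu_ext_shift n (a : 'rV[R]_n) (A : set 'rV[R]_n) :
  ((borel_lebesgue R n)^*)%mu ((fun x => x + a) @^-1` A) =
  ((borel_lebesgue R n)^*)%mu A.
Proof.
suff H (b : 'rV[R]_n) (B : set 'rV[R]_n) :
    (((borel_lebesgue R n)^*)%mu ((fun x => x + b)%R @^-1` B) <=
    ((borel_lebesgue R n)^*)%mu B)%E.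
  apply/eqP; rewrite eq_le H /=.
  rewrite [X in (((_ ^*)%mu X) <= _)%E](_ : A =
    (fun x => x + - a) @^-1` ((fun x => x + a) @^-1` A)) ?H//.
  by apply/seteqP; split => x; rewrite /= subrK.
have [F [mF BF <-]] := measurable_mu_ext_hull (borel_lebesgue R n) B.
have mG : measurable ((fun x => x + b) @^-1` F).
  by rewrite -[X in measurable X]setTI; exact: measurable_rV_shift.
rewrite -(borel_lebesgue_shift _ b _ mF) -(measurable_mu_extE _ mG).
by apply: le_mu_ext => x; exact: BF.
Qed.

Lemma measurable_lebesgue_rV_shift n (a : 'rV[R]_n) :
  measurable_fun [set: lebesgue_rV_type R n]
    ((fun x : 'rV[R]_n => x + a) : lebesgue_rV_type R n -> lebesgue_rV_type R n).
Proof.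
move=> _ A mA; rewrite setTI.
suff : caratheodory_measurable ((borel_lebesgue R n)^*)%mu
  ((fun x : 'rV[R]_n => x + a) @^-1` A) by [].
have {}mA : caratheodory_measurable ((borel_lebesgue R n)^*)%mu A by [].
move=> X.
have E (Y : set 'rV[R]_n) : ((borel_lebesgue R n)^*)%mu Y =
    ((borel_lebesgue R n)^*)%mu ((fun x => x - a) @^-1` Y).
  by rewrite mu_ext_shift.
(* Testing the translate of [A] against [X] amounts to testing [A] against the oppositely translated
   [X]. *)
have := mA ((fun x : 'rV[R]_n => x - a) @^-1` X).
rewrite -E => ->.
rewrite (E (X `&` _)) (E (X `&` ~` _)).
congr (((borel_lebesgue R n)^*)%mu _ + ((borel_lebesgue R n)^*)%mu _)%E;
 by apply/seteqP; split => x /=; rewrite subrK.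
Qed.

Lemma ge0_integral_lebesgue_rV_shift n (a : 'rV[R]_n) (f : 'rV[R]_n -> \bar R) :
  measurable_fun [set: lebesgue_rV_type R n] (f : lebesgue_rV_type R n -> _) ->
  (forall x, 0 <= f x)%E ->
  (\int[lebesgue_rV R n]_x f ((x : 'rV[R]_n) + a)%R = \int[lebesgue_rV R n]_x f x)%E.
Proof.
move=> mf f0.
have mshift := measurable_lebesgue_rV_shift n a.
rewrite -(@ge0_integral_pushforward _ _ _ _ _ _ mshift (lebesgue_rV R n) setT f)//.
by apply: eq_measure_integral => B mB _; exact: mu_ext_shift.
Qed.

End translation.

(** The averaging step in abstract form: integrate the bound over [Q], then enlarge [Q] to the whole
    space, using that [q] and [q'] are nonnegative. *)
Lemma le_integral_cstD {d : measure_display} {T : measurableType d} {R : realType}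
    (mu : {measure set T -> \bar R}) (Q : set T) (q q' : T -> R) (a k : R) :
  measurable Q -> measurable_fun setT q -> measurable_fun setT q' ->
  (forall x, 0 <= q x) -> (forall x, 0 <= q' x) -> 0 <= a -> 0 <= k ->
  (forall x, Q x -> a <= k * (q x + q' x)) ->
  (a%:E * mu Q <= k%:E * (\int[mu]_x (q x)%:E + \int[mu]_x (q' x)%:E))%E.
Proof.
move=> mQ /measurable_EFinP mq /measurable_EFinP mq' q0 q'0 a0 k0 aq.
rewrite -integral_cst//.
have mqD : measurable_fun setT (fun x => (q x)%:E + (q' x)%:E)%E.
  exact: emeasurable_funD.
apply: (@le_trans _ _ (\int[mu]_(x in Q) (k%:E * ((q x)%:E + (q' x)%:E)))%E).
  apply: ge0_le_integral => //.
  by apply: measurable_funTS; exact: measurable_funeM.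
rewrite ge0_integralZl_EFin//; last 2 first.
- by move=> x _; rewrite -EFinD lee_fin addr_ge0.
- exact: measurable_funTS.
rewrite lee_wpmul2l// ge0_integralD//; last 4 first.
- by move=> x _; rewrite lee_fin.
- exact: measurable_funTS.
- by move=> x _; rewrite lee_fin.
- exact: measurable_funTS.
by apply: leeD; apply: ge0_subset_integral => // x _; rewrite lee_fin.
Qed.

(** * Bounds on difference quotients and their average over a cube *)

Section pointwise.
Context {R : realType} (d : nat).
Implicit Types (s p : R) (f : 'rV[R]_d -> R) (x y h u : 'rV[R]_d).

Lemma le_coord_enorm x i : `|x ord0 i| <= enorm x.
Proof.
rewrite -sqrtr_sqr /enorm ler_sqrt; last by apply: sumr_ge0 => j _; exact: sqr_ge0.
by rewrite (bigD1 i)//= lerDl; apply: sumr_ge0 => j _; exact: sqr_ge0.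
Qed.

Lemma enorm_le_coord x (t : R) : 0 <= t -> (forall i, `|x ord0 i| <= t) ->
  enorm x <= d%:R * t.
Proof.
move=> t0 xt; rewrite -[leRHS]ger0_norm ?mulr_ge0// -sqrtr_sqr ler_sqrt ?sqr_ge0//.
apply: (@le_trans _ _ (\sum_(i < d) t ^+ 2)).
  apply: ler_sum => i _; rewrite -real_normK ?num_real//.
  by rewrite lerXn2r ?nnegrE.
(* The sum is [d] times [t ^+ 2], and [d] is at most its own square. *)
rewrite sumr_const card_ord -[leLHS]mulr_natl exprMn ler_wpM2r ?sqr_ge0//.
by rewrite -natrX ler_nat -mulnn; case: (d) => // k; rewrite leq_pmulr.
Qed.

Lemma enorm_ge0 x : 0 <= enorm x. Proof. exact: sqrtr_ge0. Qed.

Lemma enorm_eq0 x : enorm x = 0 -> x = 0.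
Proof.
move=> x0; apply/rowP => i; apply/eqP; rewrite mxE -normr_le0 -x0.
exact: le_coord_enorm.
Qed.

Lemma enormB_gt0 x y : x != y -> 0 < enorm (x - y).
Proof.
move=> xy; rewrite lt0r enorm_ge0 andbT; apply: contra xy => /eqP/enorm_eq0/eqP.
by rewrite subr_eq0.
Qed.

Lemma diff_quot_ge0 s p f x h : 0 <= diff_quot s p f x h.
Proof. by rewrite /diff_quot divr_ge0 ?powR_ge0. Qed.

Lemma le_diff_quot s p f x h (t : R) : 0 < s -> 0 < p -> enorm h <= t ->
  `|f (x + h) - f x| `^ p <= t `^ (d%:R + p * s) * diff_quot s p f x h.
Proof.
move=> s0 p0 ht.
(* At [h = 0] the quotient no longer controls the difference, but the left side is 0 because [p] is
   positive. *)
have [/enorm_eq0 ->|h0] := eqVneq (enorm h) 0.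
  by rewrite addr0 subrr normr0 powR0 ?gt_eqF// mulr_ge0 ?powR_ge0// diff_quot_ge0.
have hgt0 : 0 < enorm h by rewrite lt0r h0 enorm_ge0.
rewrite /diff_quot mulrCA ler_peMr ?powR_ge0// ler_pdivlMr ?powR_gt0// mul1r.
have q0 : 0 <= d%:R + p * s by rewrite addr_ge0// mulr_ge0// ltW.
have t0 : 0 <= t := le_trans (enorm_ge0 h) ht.
by apply: ge0_ler_powR; rewrite ?nnegrE ?enorm_ge0.
Qed.

(** The sum is at most twice the larger term, so monotonicity of the power suffices. *)
Lemma powRD_le p (a b : R) : 0 <= p -> 0 <= a -> 0 <= b ->
  (a + b) `^ p <= 2 `^ p * (a `^ p + b `^ p).
Proof.
move=> p0; wlog ab : a b / a <= b => [H a0 b0|a0 b0].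
  have [ab|/ltW ba] := leP a b; first exact: H.
  by rewrite addrC (addrC (a `^ p)) H.
apply: (@le_trans _ _ ((2 * b) `^ p)).
  by apply: ge0_ler_powR; rewrite ?nnegrE ?addr_ge0 ?mulr_ge0// mulr_natl mulr2n lerD2r.
by rewrite powRM// ler_wpM2l ?powR_ge0// lerDr powR_ge0.
Qed.

Lemma measurable_enorm : measurable_fun setT (@enorm R d).
Proof.
rewrite (_ : @enorm R d = fun x => (\sum_(i < d) rV_coord i x ^+ 2) `^ 2^-1).
  apply: (measurableT_comp (measurable_powR _)).
  apply: measurable_sum => i; apply: measurable_funX.
  exact: measurable_rV_coord.
by apply/funext => x; rewrite powR12_sqrt// sumr_ge0// => i _; exact: sqr_ge0.
Qed.

(** The general form serves twice: on the Lebesgue sigma-algebra with [x] fixed, and on the Borel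
    product jointly in the point and the displacement. *)
Lemma measurable_diff_quot s p (e : measure_display) (T : measurableType e)
    (F G : T -> R) (H : T -> 'rV[R]_d) :
  measurable_fun setT F -> measurable_fun setT G -> measurable_fun setT H ->
  measurable_fun setT
    (fun z => `|F z - G z| `^ p / enorm (H z) `^ (d%:R + p * s)).
Proof.
move=> mF mG mH.
under eq_fun do rewrite -powRN.
apply: measurable_funM; apply: (measurableT_comp (measurable_powR _)).
  by apply: measurableT_comp => //; exact: measurable_funB.
exact: measurableT_comp measurable_enorm mH.
Qed.

Lemma measurable_lebesgue_diff_quot s p f x :
  measurable_fun [set: lebesgue_rV_type R d] (f : lebesgue_rV_type R d -> R) ->
  measurable_fun [set: lebesgue_rV_type R d]
    (diff_quot s p f x : lebesgue_rV_type R d -> R).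
Proof.
move=> mf.
have mfx : measurable_fun [set: lebesgue_rV_type R d]
    ((fun h => f (x + h)) : lebesgue_rV_type R d -> R).
  rewrite (_ : (fun h => _) = (fun h => f (h + x))); last first.
    by apply/funext => h; rewrite addrC.
  have := measurableT_comp (T2 := lebesgue_rV_type R d) mf
    (measurable_lebesgue_rV_shift _ x).
  by [].
exact: (@measurable_diff_quot s p _ (lebesgue_rV_type R d) _ (fun=> f x) id mfx
  (measurable_cst _) (measurable_id_caratheodory (borel_lebesgue R d))).
Qed.

(* Here [u] is the displacement of [z = x + u] from [x], so that [u + (x - y)]
   is its displacement from [y]; only sup-norm bounds are used, which avoids the
   triangle inequality for [enorm]. *)
Lemma le_diff_quotD s p f x y u : 0 < s -> 0 < p ->
  (forall i, `|u ord0 i| <= enorm (x - y)) ->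
  `|f x - f y| `^ p <= 2 `^ p * (d%:R * (enorm (x - y) *+ 2)) `^ (d%:R + p * s) *
    (diff_quot s p f x u + diff_quot s p f y (u + (x - y))).
Proof.
move=> s0 p0 ur; set r := enorm (x - y); set t := d%:R * _.
have r0 : 0 <= r by exact: enorm_ge0.
have ut : enorm u <= t.
  apply: enorm_le_coord => [|i]; first by rewrite mulrn_wge0.
  by rewrite (le_trans (ur i))// mulr2n lerDl.
have uxyt : enorm (u + (x - y)) <= t.
  apply: enorm_le_coord => [|i]; first by rewrite mulrn_wge0.
  rewrite mxE (le_trans (ler_normD _ _))// mulr2n lerD//.
  exact: le_coord_enorm.
have -> : f x - f y = (f (y + (u + (x - y))) - f y) - (f (x + u) - f x).
  rewrite (_ : y + (u + (x - y)) = x + u); last by rewrite addrCA addrC subrKC addrC.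
  by rewrite opprB [RHS]addrC addrA subrK.
apply: (@le_trans _ _ ((`|f (y + (u + (x - y))) - f y| + `|f (x + u) - f x|) `^ p)).
  by apply: ge0_ler_powR; rewrite ?nnegrE ?addr_ge0 ?ler_normB//; exact: ltW.
apply: le_trans (powRD_le _ _ _ (ltW p0) _ _) _ => //.
rewrite -mulrA ler_wpM2l ?powR_ge0// addrC mulrDr lerD// le_diff_quot//.
Qed.

Local Open Scope ereal_scope.
Local Notation mu := (lebesgue_rV R d).

(** The bound for a single displacement [u] is integrated over the cube of half-side
    [enorm (x - y)], whose volume is the factor on the left. *)
Lemma le_integral_diff_quotD s p f x y : (0 < s)%R -> (0 < p)%R -> x != y ->
  measurable_fun [set: lebesgue_rV_type R d] (f : lebesgue_rV_type R d -> R) ->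
  (`|f x - f y| `^ p * (enorm (x - y) *+ 2) ^+ d)%:E <=
    (2 `^ p * (d%:R * (enorm (x - y) *+ 2)) `^ (d%:R + p * s))%:E *
    (\int[mu]_h (diff_quot s p f x h)%:E + \int[mu]_h (diff_quot s p f y h)%:E).
Proof.
move=> s0 p0 xy mf; set r := enorm (x - y); set K := (2 `^ p * _)%R.
have r0 : (0 < r)%R by exact: enormB_gt0.
pose Q : set (lebesgue_rV_type R d) :=
  [set u : 'rV[R]_d | forall i, (`|u ord0 i| <= r)%R].
have mQ0 := @measurable_cube R d r.
have mQ : measurable Q by exact: (sub_measurable_caratheodory (borel_lebesgue R d)).
have muQ : mu Q = ((r *+ 2) ^+ d)%:E.
  rewrite -(borel_lebesgue_cube d _ r0).
  exact: (@measurable_mu_extE _ _ _ (borel_lebesgue R d)).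
pose q' u := diff_quot s p f y (u + (x - y)).
have mqy : measurable_fun [set: lebesgue_rV_type R d]
    (EFin \o (diff_quot s p f y : lebesgue_rV_type R d -> R)).
  by apply/measurable_EFinP; exact: measurable_lebesgue_diff_quot.
have mq' : measurable_fun [set: lebesgue_rV_type R d] (q' : lebesgue_rV_type R d -> R).
  have := measurableT_comp (T2 := lebesgue_rV_type R d)
    (measurable_lebesgue_diff_quot s p f y mf)
    (measurable_lebesgue_rV_shift _ (x - y)).
  by [].
(* The second integral is translated by [x - y], so that both integrands depend on the same [u]. *)
rewrite EFinM -muQ -(ge0_integral_lebesgue_rV_shift _ (x - y) _ mqy); last first.
  by move=> h; rewrite lee_fin diff_quot_ge0.
apply: (@le_integral_cstD _ _ _ mu Q (diff_quot s p f x) q' _ _ mQ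
  (measurable_lebesgue_diff_quot s p f x mf) mq').
- by move=> u; exact: diff_quot_ge0.
- by move=> u; exact: diff_quot_ge0.
- exact: powR_ge0.
- by rewrite mulr_ge0// powR_ge0.
- by move=> u Qu; exact: le_diff_quotD.
Qed.

End pointwise.

(** * The pointwise inequality with its constant, and integrability of [Dsp] *)

Section sobolev.
Context {R : realType} (d : nat).
Implicit Types (s p : R) (f : 'rV[R]_d -> R) (x y h u : 'rV[R]_d).

(** Inside the root, the leading 2 comes from adding two terms each at most [D ^ p], and [2 ^ p]
    from splitting [f x - f y]. The rest is what remains of (2dr)^(d+ps) after division by the
    volume (2r)^d and by r^(ps). *)
Definition pointwise_cst p s : R :=
  (2 * (2 `^ p * d%:R `^ (d%:R + p * s) * 2 `^ (p * s))) `^ p^-1.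

Lemma pointwise_cst_gt0 p s : (0 < d)%N -> 0 < pointwise_cst p s.
Proof. by move=> d0; rewrite powR_gt0// !mulr_gt0// powR_gt0// ltr0n. Qed.

(** Both sides are compared through their [p]-th powers. Here [a] stands for the difference of
    values, and [i], [j] for the two integrals when finite. *)
Lemma le_pointwise_cst p s (a r i j : R) : 0 < p -> 0 < s -> 0 < r ->
  0 <= a -> 0 <= i -> 0 <= j ->
  a `^ p * (r *+ 2) ^+ d <=
    2 `^ p * (d%:R * (r *+ 2)) `^ (d%:R + p * s) * (i + j) ->
  a <= pointwise_cst p s * r `^ s * (i `^ p^-1 + j `^ p^-1).
Proof.
move=> p0 s0 r0 a0 i0 j0; set D := i `^ p^-1 + _ => H.
have D0 : 0 <= D by rewrite addr_ge0 ?powR_ge0.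
have leD c : 0 <= c -> c `^ p^-1 <= D -> c <= D `^ p.
  move=> c0 cD; rewrite -[leLHS]powRr1// -(mulVf (lt0r_neq0 p0)) powRrM.
  by apply: ge0_ler_powR; rewrite ?nnegrE ?powR_ge0// ltW.
have ijD : i + j <= 2 * D `^ p.
  by rewrite mulr_natl mulr2n lerD// leD// ?lerDl ?lerDr ?powR_ge0.
have r20 : 0 < r *+ 2 by rewrite mulrn_wgt0.
have ap : a `^ p <= (pointwise_cst p s * r `^ s * D) `^ p.
  rewrite powRM// ?mulr_ge0 ?powR_ge0// (powRM _ (powR_ge0 _ _) (powR_ge0 _ _)).
  rewrite /pointwise_cst -!powRrM mulVf ?lt0r_neq0// powRr1; last first.
    by rewrite !mulr_ge0 ?powR_ge0.
  (* Restoring the volume factor gives the left side of [H]; expanding (2dr)^(d+ps) then makes that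
     factor common to both sides. *)
  rewrite -(ler_pM2r (exprn_gt0 d r20)); apply: (le_trans H).
  rewrite (powRM _ _ (ltW r20))// (@powRD _ (r *+ 2)); last first.
    by rewrite (gt_eqF r20) implybT.
  have -> : (r *+ 2) `^ (p * s) = 2 `^ (p * s) * r `^ (p * s).
    by rewrite -powRM ?(ltW r0)// mulr_natl.
  rewrite (powR_mulrn _ (ltW r20)).
  set c1 := 2 `^ p; set c2 := d%:R `^ _; set c3 := 2 `^ _.
  rewrite (mulrC s p).
  rewrite [leLHS](_ : _ = (c1 * c2 * c3 * r `^ (p * s) * (r *+ 2) ^+ d) * (i + j)).
    rewrite [leRHS](_ : _ =
      (c1 * c2 * c3 * r `^ (p * s) * (r *+ 2) ^+ d) * (2 * D `^ p)).
      by rewrite ler_wpM2l// !mulr_ge0 ?powR_ge0// exprn_ge0// ltW.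
    by ring.
  by ring.
rewrite leNgt; apply/negP => /(gt0_ltr_powR p0).
rewrite !nnegrE => /(_ _ a0); rewrite ltNge ap => /(_ _)/negP; apply => //.
by rewrite !mulr_ge0 ?powR_ge0.
Qed.

Local Open Scope ereal_scope.
Local Notation mu := (lebesgue_rV R d).

Lemma integral_diff_quot_ge0 s p f x : 0 <= \int[mu]_h (diff_quot s p f x h)%:E.
Proof. by apply: integral_ge0 => h _; rewrite lee_fin diff_quot_ge0. Qed.

Lemma le_Dsp s p f x y : (0 < d)%N -> (0 < s)%R -> (0 < p)%R -> x != y ->
  measurable_fun [set: lebesgue_rV_type R d] (f : lebesgue_rV_type R d -> R) ->
  (`|f x - f y|%:E <= (pointwise_cst p s * enorm (x - y) `^ s)%:E *
    (Dsp s p f x + Dsp s p f y)).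
Proof.
move=> d0 s0 p0 xy mf.
have r0 : (0 < enorm (x - y))%R by exact: enormB_gt0.
have c0 : (0 < pointwise_cst p s * enorm (x - y) `^ s)%R.
  by apply: mulr_gt0; [exact: pointwise_cst_gt0|exact: powR_gt0].
have := le_integral_diff_quotD _ s p f x y s0 p0 xy mf.
have := integral_diff_quot_ge0 s p f x; have := integral_diff_quot_ge0 s p f y.
rewrite /Dsp.
move: (\int[mu]_h (diff_quot s p f x h)%:E) (\int[mu]_h (diff_quot s p f y h)%:E).
have pV0 : p^-1%R != 0%R by rewrite invr_eq0 gt_eqF.
(* When an integral is infinite so is its root, and the positive factor [c0] keeps the right side
   infinite. *)
move=> [i| |] [j| |]//; rewrite ?lee_fin => j0 i0 H; last 3 first.
- by rewrite (poweRyr pV0) addey ?gt0_muley ?leey.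
- by rewrite (poweRyr pV0) addye ?gt0_muley ?leey.
- by rewrite (poweRyr pV0) addye// gt0_muley ?leey.
exact: le_pointwise_cst.
Qed.

(* [f] is only Lebesgue measurable, so [(x, h) |-> f (x + h)] need not be measurable
   for a product sigma-algebra: Tonelli is applied to a Borel function [g] equal
   to [f] off a Borel null set. *)
Lemma in_Lp_Dsp s p f : (0 < p)%R ->
  measurable_fun [set: lebesgue_rV_type R d] (f : lebesgue_rV_type R d -> R) ->
  \int[mu]_h \int[mu]_x (diff_quot s p f x h)%:E < +oo ->
  in_Lp p (Dsp s p f).
Proof.
move=> p0 mf foo.
pose m := borel_lebesgue R d.
have [g [N [mg mN N0 fg]]] := caratheodory_ae_measurable m f mf.
pose q (z : 'rV[R]_d * 'rV[R]_d) := (diff_quot s p g z.1 z.2)%:E.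
have q0 z : 0 <= q z by rewrite lee_fin diff_quot_ge0.
have mD : measurable_fun setT (fun z : 'rV[R]_d * 'rV[R]_d => (z.1 + z.2)%R).
  apply: measurable_fun_rV => i.
  rewrite (_ : _ \o _ = fun z => (rV_coord i z.1 + rV_coord i z.2)%R).
    by apply: measurable_funD; apply: (measurableT_comp (measurable_rV_coord i)).
  by apply/funext => z; rewrite /rV_coord /= mxE.
have mq : measurable_fun setT q.
  apply/measurable_EFinP; apply: measurable_diff_quot => //.
  - exact: (measurableT_comp mg mD).
  - exact: (measurableT_comp mg measurable_fst).
have mq1 x : measurable_fun setT (fun h => q (x, h)).
  exact: (measurableT_comp mq (measurable_pair1 x)).
have mq2 h : measurable_fun setT (fun x => q (x, h)).
  exact: (measurableT_comp mq (measurable_pair2 h)).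
have mNs z : measurable ((fun x => x + z)%R @^-1` N).
  by rewrite -[X in measurable X]setTI; exact: measurable_rV_shift.
have Ns0 z : m ((fun x => x + z)%R @^-1` N) = 0 by rewrite /m borel_lebesgue_shift.
pose I x := \int[mu]_h (diff_quot s p f x h)%:E.
have I0 x : 0 <= I x by exact: integral_diff_quot_ge0.
pose J x := \int[m]_h q (x, h).
have J0 x : 0 <= J x by exact: integral_ge0.
have mJ : measurable_fun setT J by exact: measurable_fun_fubini_tonelli_F.
(* With [x] outside [N], replacing [f] by [g] alters the integrand only for [h] in the null
   translate [N - x]. *)
have IJ x : ~ N x -> I x = J x.
  move=> Nx.
  have [] // := @ge0_integral_caratheodory_ae _ _ _ m
    (fun h => (diff_quot s p f x h)%:E) _ _ (mNs x) (Ns0 x) _ (mq1 x).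
  - move=> h Nh; rewrite /q /diff_quot /= fg ?(fg x)//.
    by rewrite addrC.
  - by move=> h; rewrite lee_fin diff_quot_ge0.
have [mI iI] := @ge0_integral_caratheodory_ae _ _ _ m I J N mN N0 IJ mJ I0 J0.
(* This holds for every [h]: the exceptional points [x] lie in the null set formed by [N] and its
   translate [N - h]. *)
have fq h : \int[mu]_x (diff_quot s p f x h)%:E = \int[m]_x q (x, h).
  have [] // := @ge0_integral_caratheodory_ae _ _ _ m
    (fun x => (diff_quot s p f x h)%:E) _ _ (measurableU _ _ mN (mNs h)) _ _ (mq2 h).
  - exact: (null_set_setU mN (mNs h) N0 (Ns0 h)).
  - move=> x /not_orP[Nx Nxh]; rewrite /q /diff_quot /= fg ?(fg x)//.
  - by move=> x; rewrite lee_fin diff_quot_ge0.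
(* The order of integration is exchanged only for the Borel integrand [q]; the passages to and from
   the completed measure occur at the two ends. *)
have ioo : \int[mu]_x I x < +oo.
  suff -> : \int[mu]_x I x = \int[mu]_h \int[mu]_x (diff_quot s p f x h)%:E by [].
  transitivity (\int[m]_x J x); first exact: iI.
  transitivity (\int[m]_h \int[m]_x q (x, h)); first exact: (fubini_tonelli _ mq q0).
  transitivity (\int[mu]_h \int[m]_x q (x, h)); last first.
    by apply: eq_integral => h _; rewrite fq.
  have mG := @measurable_fun_fubini_tonelli_G _ _ _ _ _ m q mq q0.
  apply/esym; apply: (ge0_integral_caratheodory m _ mG) => h.
  exact: integral_ge0.
split; first exact: (measurableT_comp (measurable_poweR _) mI).
(* The [p]-th power of [Dsp] is [I], so the norm is a power of the integral of [I]. *)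
rewrite unlock; apply: poweR_lty.
rewrite [X in X < _](_ : _ = \int[mu]_x I x)//; apply: eq_integral => x _ /=.
by rewrite gee0_abs ?poweR_ge0// -poweRrM mulVf ?gt_eqF// poweRe1 ?I0.
Qed.

End sobolev.

Theorem proposition2p12 (R : realType) (d : nat) (p s : R)
    (hd : (1 <= d)%N) (hp : 1 <= p) (hs0 : 0 < s) (hs1 : s < 1) :
  exists C : R, 0 < C /\
    forall f : 'rV[R]_d -> R, Wsp s p f ->
      (forall x y : 'rV[R]_d, x != y ->
         (`|f x - f y|%:E <=
          (C * enorm (x - y) `^ s)%:E * (Dsp s p f x + Dsp s p f y))%E) /\
      in_Lp p (Dsp s p f).
Proof.
have p0 : 0 < p := lt_le_trans ltr01 hp.
exists (pointwise_cst d p s); split; first exact: pointwise_cst_gt0.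
move=> f [/sub_Lfun_mfun + foo]; rewrite inE => mf; split.
  by move=> x y xy; exact: le_Dsp.
exact: in_Lp_Dsp.
Qed.
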